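(* Let $d\ge 1$ be an integer, let $0<\alpha<1/3$ and $p_n=n^{-\alpha}$. Then, with high probability, the Linial–Meshulam complex $Y_d(n,p_n)$ is exactly reconstructable from its $1$-neighbourhoods; that is, the event ''every complex $\widetilde X$ of the form described in the context with $N_{1,\widetilde X}(\sigma)\simeq N_{1,Y_d(n,p_n)}(\sigma)$ for all $\sigma\in X_{d-1}$ satisfies $\widetilde X=Y_d(n,p_n)$'' occurs with high probability.
   Context: Let $X_0=\{1,\dots,n\}$ and, for $k\ge 0$, let $X_k$ be the set of all $(k+1)$-element subsets of $X_0$ ($k$-simplices); $X_{-1}=\{\emptyset\}$. A complex ''of the form'' considered is $X=\left(\bigcup_{k=-1}^{d-1}X_k\right)\cup X^d$ with $X^d\subseteq X_d$. The Linial–Meshulam model $Y_d(n,p)$ is the random such complex in which each element of $X_d$ is put in $X^d$ independently with probability $p$. For $\sigma,\sigma'\in X_{d-1}$ write $\sigma\sim\sigma'$ if $\sigma\cup\sigma'\in X^d$; let $S_\sigma=\{\sigma'\in X_{d-1}:\sigma'\sim\sigma\}$ and $X_{\sigma,1}=\{\sigma\}\cup S_\sigma$. The $1$-neighbourhood of $\sigma\in X_{d-1}$ is $N_{1,X}(\sigma)=\{\tau\in X:\tau\subseteq\sigma'\cup\sigma''\text{ for some }\sigma',\sigma''\in X_{\sigma,1}\}$. Two set systems closed under subsets, $A$ on vertex set $V$ and $B$ on vertex set $W$, are isomorphic ($A\simeq B$) if there is a bijection $f:V\to W$ with $\tau\in A\iff f(\tau)\in B$. A sequence of events $A_n$ occurs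 with high probability if $P(A_n^c)=o(n^{-s})$ for some $s>0$. *)

(* Defs.v *)
From HB Require Import structures.
From mathcomp Require Import all_boot all_order all_algebra.
From mathcomp Require Import all_classical all_reals all_analysis.

Set Implicit Arguments.
Unset Strict Implicit.
Unset Printing Implicit Defensive.

Import Order.TTheory GRing.Theory Num.Theory.
Import numFieldNormedType.Exports.

Local Open Scope set_scope.
Local Open Scope ring_scope.

(* The vertex set {1, ..., n} is encoded as 'I_n = {0, ..., n - 1}. *)
Definition simplices (n k : nat) : {set {set 'I_n}} :=
  [set tau : {set 'I_n} | #|tau| == k.+1].

(* A complex with full (d-1)-skeleton is represented by its set Xd of
   d-simplices, always assumed to be a subset of simplices n d; the term [set set0]
   is X_{-1}. The definitions below that use d.-1 are meant for d >= 1. *)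
Definition complex_of (n d : nat) (Xd : {set {set 'I_n}}) : {set {set 'I_n}} :=
  [set finset.set0] :|: (\bigcup_(k < d) simplices n k)%SET :|: Xd.

Definition adjacent (n : nat) (Xd : {set {set 'I_n}}) (sigma sigma' : {set 'I_n}) :
  bool := sigma :|: sigma' \in Xd.

Definition sphere1 (n d : nat) (Xd : {set {set 'I_n}}) (sigma : {set 'I_n}) :
    {set {set 'I_n}} :=
  [set sigma' in simplices n d.-1 | adjacent Xd sigma' sigma].

Definition ball1 (n d : nat) (Xd : {set {set 'I_n}}) (sigma : {set 'I_n}) :
    {set {set 'I_n}} :=
  sigma |: sphere1 d Xd sigma.

Definition nbhd1 (n d : nat) (Xd : {set {set 'I_n}}) (sigma : {set 'I_n}) :
    {set {set 'I_n}} :=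
  [set tau in complex_of d Xd |
    [exists sigma' in ball1 d Xd sigma, exists sigma'' in ball1 d Xd sigma,
      tau \subset sigma' :|: sigma'']].

(* The vertex set of a set system A is cover A, the union of its members; f is a
   bijection from cover A onto cover B, its values elsewhere being irrelevant. *)
Definition isomorphic (T : finType) (A B : {set {set T}}) : Prop :=
  exists f : T -> T,
    [/\ {in finset.cover A &, injective f},
        f @: finset.cover A = finset.cover B &
        forall tau : {set T}, tau \subset finset.cover A ->
          (tau \in A) = (f @: tau \in B)].

Definition exactly_reconstructable (n d : nat) (Xd : {set {set 'I_n}}) : Prop :=
  forall Xd' : {set {set 'I_n}}, Xd' \subset simplices n d ->
    (forall sigma, sigma \in simplices n d.-1 ->
      isomorphic (nbhd1 d Xd' sigma) (nbhd1 d Xd sigma)) ->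
    complex_of d Xd' = complex_of d Xd.

(* Law of the random set of d-simplices of Y_d(n, p): the product over all
   d-simplices of Bernoulli(p) laws, supported on the subsets of simplices n d. *)
Definition LM_mass (R : realType) (n d : nat) (p : R) (Xd : {set {set 'I_n}}) : R :=
  \prod_(tau in simplices n d) (if tau \in Xd then p else 1 - p).

Definition LM_prob (R : realType) (n d : nat) (p : R)
    (E : {set {set {set 'I_n}}}) : R :=
  \sum_(Xd in E | Xd \subset simplices n d) LM_mass d p Xd.

(* Sanity check: total mass 1 (S empty), each d-simplex is present with
   probability p (S a singleton), and these events are mutually independent. *)
Lemma LM_prob_supset (R : realType) (n d : nat) (p : R) (S : {set {set 'I_n}}) :
  S \subset simplices n d ->
  LM_prob d p [set Xd : {set {set 'I_n}} | S \subset Xd] = p ^+ #|S|.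
Proof.
move=> /fintype.subsetP sSX.
pose F (t : {set 'I_n}) : R := if t \in simplices n d then p else 0.
pose G (t : {set 'I_n}) : R :=
  if t \in simplices n d then (if t \in S then 0 else 1 - p) else 1.
have := @bigA_distr R 0 1 *%R +%R _ F G.
have -> : \prod_t (F t + G t) = p ^+ #|S|.
  rewrite -prodr_const [RHS]big_mkcond; apply: eq_bigr => t _.
  rewrite /F /G; case: ifPn => [_|tX].
    by case: ifP => _; rewrite ?addr0 // addrC subrK.
  by rewrite add0r ifN //; apply: contra tX; exact: sSX.
move=> ->; rewrite /LM_prob big_mkcond; apply: eq_bigr => J _.
rewrite inE; case: ifPn => [/andP[/fintype.subsetP SJ /fintype.subsetP JX]|].
  rewrite /LM_mass big_mkcond; apply: eq_bigr => t _; rewrite /F /G.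
  case: (boolP (t \in J)) => [/JX ->//|tJ]; case: ifP => // _.
  by rewrite ifN //; apply: contra tJ; exact: SJ.
rewrite negb_and => /orP[] /fintype.subsetPn[t t1 t2]; rewrite (bigD1 t) //=.
  by rewrite (negbTE t2) /G sSX // t1 mul0r.
by rewrite t1 /F (negbTE t2) mul0r.
Qed.

Definition with_high_probability (R : realType) (Omega : nat -> finType)
    (P : forall n, {set Omega n} -> R) (A : forall n, {set Omega n}) : Prop :=
  exists2 s : R, 0 < s &
    (fun n : nat => P n (~: A n) : R^o)
      =o_ (\oo%classic) (fun n : nat => n%:R `^ (- s) : R^o).

(* Main.v *)
Require Import Defs.
From HB Require Import structures.
From mathcomp Require Import all_boot all_order all_algebra.
From mathcomp Require Import all_classical all_reals all_analysis.
From mathcomp Require Import zify ring lra.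

(* For a set r of d - 1 vertices and vertices u, v, let W(r; u, v) be the set of
   common neighbours of u and v in the link graph of r, whose edges are the pairs
   {w, w'} such that r + w + w' is a d-simplex.  Suppose that
   (a) every W(r; u, v) has at least 2m + d elements not adjacent to z, for each
       third vertex z, and
   (b) two disjoint systems of simplices r1 + a_i + a_j and r2 + b_i + b_j never
       have the same membership pattern, for 2m-tuples a and b.
   By (a), in the neighbourhood of s only s itself is completed to a d-simplex by
   every other vertex, so each isomorphism of neighbourhoods of s maps s to s.
   If t is a d-simplex of the other complex and x, y are in t, then the
   isomorphisms at t - x and t - y carry the graph on W(t - x - y; x, y) onto two
   such graphs of the given complex; by (a) and (b) these come from the same
   d-simplex, which contains both t - x and t - y, hence is t.  This gives one
   inclusion, and the other one follows since links have equal cardinalities.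
   A union bound over all tuples shows that (a) and (b) fail with probability at
   most n^(2m+2d+2) (1 - p^2 (1-p))^(n-2m-2d-2) + n^(4m+2d-2) (1 - 2p(1-p))^(m^2),
   which is at most 2 n^-2 for m about n^((1 - alpha) / 2), as alpha < 1/3. *)

Set Implicit Arguments.
Unset Strict Implicit.
Unset Printing Implicit Defensive.

Import Order.TTheory GRing.Theory Num.Theory.
Import numFieldNormedType.Exports.

Local Open Scope set_scope.
Local Open Scope ring_scope.

(** * Enumeration of finite sets by functions *)

Section Enumerations.
Import boot.fintype boot.finset.

Lemma inj_into (T T' : finType) (U : {set T'}) : (#|T| <= #|U|)%N ->
  exists2 h : T -> T', injective h & forall x, h x \in U.
Proof.
move=> TU; exists (fun x => enum_val (widen_ord TU (enum_rank x))).
  by move=> x y /enum_val_inj /(congr1 val) /= /val_inj /enum_rank_inj.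
by move=> x; exact: enum_valP.
Qed.

(** Sets become tuples, possibly with repetitions, so that the union bound counts at most [n ^ k]
    vertex sets of size at most [k]. The default [x0] fills the positions beyond the end of
    [enum A]. *)
Lemma subset_imset_ffun (T : finType) (x0 : T) (A : {set T}) k : (#|A| <= k)%N ->
  exists s : {ffun 'I_k -> T}, A \subset [set s i | i : 'I_k].
Proof.
move=> Ak; exists [ffun i : 'I_k => nth x0 (enum A) i]; apply/subsetP => x xA.
have iA : (index x (enum A) < k)%N.
  by apply: leq_trans Ak; rewrite cardE index_mem mem_enum.
by apply/imsetP; exists (Ordinal iA) => //; rewrite ffunE /= nth_index // mem_enum.
Qed.

Lemma eq_imset_ffun (T : finType) (x0 : T) (A : {set T}) k : #|A| = k ->
  exists s : {ffun 'I_k -> T}, A = [set s i | i : 'I_k].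
Proof.
move=> Ak; have [s As] := subset_imset_ffun x0 (eq_leq Ak); exists s.
apply/eqP; rewrite eqEcard As Ak /=.
by apply: leq_trans (leq_imset_card _ _) _; rewrite card_ord.
Qed.

End Enumerations.

(** * Reconstruction from separation and absence of twins *)

Section Neighbourhoods.
Import boot.fintype boot.finset.
Variables (n d : nat).
Hypothesis d_gt0 : (0 < d)%N.
Implicit Types (X : {set {set 'I_n}}) (s t r : {set 'I_n}) (u v w x y z : 'I_n).

Definition link X s : {set 'I_n} := [set v | v |: s \in X].

Definition common_link X r u v : {set 'I_n} :=
  [set w | (u |: (w |: r) \in X) && (v |: (w |: r) \in X)].

Definition separated_link X r u v z : {set 'I_n} :=
  [set w in common_link X r u v | z |: (w |: r) \notin X].

Lemma card_simplex X t : X \subset simplices n d -> t \in X -> #|t| = d.+1.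
Proof. by move=> /subsetP h /h; rewrite inE => /eqP. Qed.

Lemma facetE s : (s \in simplices n d.-1) = (#|s| == d).
Proof. by rewrite inE prednK. Qed.

Lemma notin_link X s v : X \subset simplices n d -> #|s| = d ->
  v \in link X s -> v \notin s.
Proof.
move=> XD sd; rewrite inE => /(card_simplex XD); rewrite cardsU1 sd.
by case: (v \in s) => //= /eqP; rewrite add0n -[X in X == _]addn0 -addn1 eqn_add2l.
Qed.

(** A neighbour [s'] of [s] adds exactly one vertex to [s], because [s' :|: s] has [d + 1] vertices;
    adding this vertex to [s] gives the simplex [s' :|: s]. *)
Lemma link_ball1 X s s' : X \subset simplices n d -> #|s| = d ->
  s' \in ball1 d X s ->
  s' \subset s :|: link X s /\ (#|s' :\: s| <= 1)%N.
Proof.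
move=> XD sd /setU1P[->|]; first by rewrite subsetUl setDv cards0.
rewrite inE facetE => /andP[/eqP s'd]; rewrite /Defs.adjacent => uX.
have cu := card_simplex XD uX.
have c1 : #|s' :\: s| = 1%N.
  by move: (cardsUI s' s) (cardsID s s'); rewrite cu sd s'd; lia.
split; last by rewrite c1.
apply/subsetP => x xs'; rewrite inE; case: (boolP (x \in s)) => //= xs.
rewrite inE; suff -> : x |: s = s' :|: s by [].
apply/eqP; rewrite eqEcard cu cardsU1 xs sd leqnn andbT.
by apply: setSU; rewrite sub1set.
Qed.

Lemma nbhd1_simplex X s t : t \in nbhd1 d X s -> #|t| = d.+1 -> t \in X.
Proof.
rewrite inE => /andP[+ _] td; rewrite !inE => /orP[/orP[]|//].
  by move=> /eqP t0; rewrite t0 cards0 in td.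
by move=> /bigcupP[k _]; rewrite inE td => /eqP[dk]; have := ltn_ord k; rewrite -dk ltnn.
Qed.

Lemma nbhd1_card X s t : X \subset simplices n d -> #|s| = d ->
  t \in nbhd1 d X s -> (#|t :\: s| <= 2)%N /\ t \subset s :|: link X s.
Proof.
move=> XD sd; rewrite inE => /andP[_] /existsP[s1 /andP[+ /existsP[s2 /andP[+ ts]]]].
move=> /(link_ball1 XD sd)[l1 c1] /(link_ball1 XD sd)[l2 c2]; split.
  apply: leq_trans (subset_leq_card (setSD s ts)) _; rewrite setDUl.
  by apply: leq_trans (leq_card_setU _ _) _; rewrite -[2%N]/(1 + 1)%N leq_add.
by apply: fintype.subset_trans ts _; rewrite subUset l1.
Qed.

Lemma nbhd1_center X s : #|s| = d -> s \in nbhd1 d X s.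
Proof.
move=> sd; rewrite inE; apply/andP; split.
  rewrite !inE; apply/orP; left; apply/orP; right; apply/bigcupP.
  have dd : (d.-1 < d)%N by rewrite prednK.
  by exists (Ordinal dd) => //; rewrite facetE sd.
by apply/existsP; exists s; rewrite setU11; apply/existsP; exists s; rewrite setU11 subsetUl.
Qed.

Lemma link_facet_ball1 X s a v : X \subset simplices n d -> #|s| = d ->
  a \in s -> v \in link X s -> v |: (s :\ a) \in ball1 d X s.
Proof.
move=> XD sd sa vl; have vs := notin_link XD sd vl.
apply/setU1P; right; rewrite inE facetE cardsU1 !inE (negbTE vs) andbF add1n.
have := cardsD1 a s; rewrite sa sd add1n => -[<-]; rewrite eqxx /=.
rewrite /Defs.adjacent -setUA; have -> : s :\ a :|: s = s by apply/setUidPr/subD1set.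
by rewrite inE in vl.
Qed.

Lemma card_link2 s a v w : #|s| = d -> a \in s -> v \notin s ->
  w \notin s -> v != w -> #|v |: (w |: (s :\ a))| = d.+1.
Proof.
move=> sd sa vs ws vw; have := cardsD1 a s; rewrite sa sd add1n => sa1.
by rewrite !cardsU1 !inE (negbTE vw) (negbTE vs) (negbTE ws) !andbF !add1n -sa1.
Qed.

(** The facets [v |: s :\ a] and [w |: s :\ a] lie in the ball and cover the simplex. So the
    neighbourhood of [s] shows the whole link graph of [s :\ a] on [link X s]. *)
Lemma nbhd1_link2 X s a v w : X \subset simplices n d -> #|s| = d ->
  a \in s -> v \in link X s -> w \in link X s -> v != w ->
  (v |: (w |: (s :\ a)) \in nbhd1 d X s) = (v |: (w |: (s :\ a)) \in X).
Proof.
move=> XD sd sa vl wl vw; apply/idP/idP => [/nbhd1_simplex|hX].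
  by apply; apply: card_link2 => //; apply: notin_link vl || apply: notin_link wl.
rewrite inE [_ \in complex_of _ _]inE hX orbT /=.
apply/existsP; exists (v |: s :\ a); rewrite link_facet_ball1 //.
apply/existsP; exists (w |: s :\ a); rewrite link_facet_ball1 //=.
by apply/subsetP => x; rewrite !inE => /or3P[->|->|->]; rewrite ?orbT.
Qed.

Lemma nbhd1_link X s v : X \subset simplices n d -> #|s| = d ->
  (v |: s \in nbhd1 d X s) && (v \notin s) = (v \in link X s).
Proof.
move=> XD sd; apply/andP/idP => [[/nbhd1_simplex + vs]|vl].
  by rewrite cardsU1 vs sd add1n inE => ->.
have vs := notin_link XD sd vl; split => //.
have [a sa] : exists a, a \in s by apply/card_gt0P; rewrite sd.
rewrite inE [_ \in complex_of _ _]inE.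
have -> : v |: s \in X by rewrite inE in vl.
rewrite orbT /=; apply/existsP; exists s; rewrite setU11 /=.
apply/existsP; exists (v |: s :\ a); rewrite link_facet_ball1 //=.
by apply/subsetP => x; rewrite !inE => /orP[->|->]; rewrite ?orbT.
Qed.

Lemma cover_nbhd1 X s : X \subset simplices n d -> #|s| = d ->
  cover (nbhd1 d X s) = s :|: link X s.
Proof.
move=> XD sd; apply/setP => x; apply/bigcupP/idP => [[t tN xt]|].
  by have [_ /subsetP] := nbhd1_card XD sd tN; apply.
rewrite !inE => /orP[xs|xl]; first by exists s => //; exact: nbhd1_center.
exists (x |: s); last exact: setU11.
by have := nbhd1_link x XD sd; rewrite [x \in link _ _]inE xl => /andP[].
Qed.

Lemma disjoint_link X s : X \subset simplices n d -> #|s| = d ->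
  s :&: link X s = set0.
Proof.
move=> XD sd; apply/setP => x; rewrite in_setI in_set0.
by apply/andP => -[xs /(notin_link XD sd)]; rewrite xs.
Qed.

(** Condition (a), with [k] in place of 2m + d. *)
Definition well_separated X k := forall r u v z,
  #|r| = d.-1 -> u \notin r -> v \notin r -> z \notin r ->
  u != v -> u != z -> v != z -> (k <= #|separated_link X r u v z|)%N.

(** Otherwise, for every [y] in the link of [s] but outside [f @: s], the set [y |: f @: s] is a
    simplex with at most two vertices outside [s]. This forces [f @: s = v |: (s :\ a)] with [v]
    outside [s], whereas separation gives such a [y] that is not adjacent to [v] in the link graph
    of [s :\ a]. *)
Lemma iso_center X X' s f k :
  X \subset simplices n d -> X' \subset simplices n d -> #|s| = d ->
  well_separated X k -> (d < k)%N -> (d + 2 <= n)%N ->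
  {in cover (nbhd1 d X' s) &, injective f} ->
  f @: cover (nbhd1 d X' s) = cover (nbhd1 d X s) ->
  (forall t, t \subset cover (nbhd1 d X' s) ->
     (t \in nbhd1 d X' s) = (f @: t \in nbhd1 d X s)) ->
  f @: s = s.
Proof.
move=> XD X'D sd ws dk dn finj fcov fiso.
have scov : s \subset cover (nbhd1 d X' s) by rewrite cover_nbhd1 // subsetUl.
have fs : f @: s \in nbhd1 d X s by rewrite -fiso // nbhd1_center.
have cfs : #|f @: s| = d.
  by rewrite card_in_imset // => x y xs ys; apply: finj; apply: (subsetP scov).
apply/eqP; apply/negPn/negP => fss.
have [v vfs vs] : exists2 v, v \in f @: s & v \notin s.
  by apply/subsetPn; apply: contra fss => h; rewrite eqEcard h sd cfs /=.
have [a sa afs] : exists2 a, a \in s & a \notin f @: s.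
  by apply/subsetPn; apply: contra fss => h; rewrite eq_sym eqEcard h sd cfs /=.
have ra : #|s :\ a| = d.-1 by have := cardsD1 a s; rewrite sa sd add1n => ->.
(* The vertex [v'] completes [a] and [v] to three distinct vertices outside [s :\ a], as separation
   demands; [d + 2 <= n] provides it. *)
have [v' /[!inE] /norP[v's]] : exists v', v' \in ~: (s :|: [set v]).
  apply/card_gt0P; have := cardsC (s :|: [set v]).
  rewrite card_ord setUC cardsU1 vs sd add1n => h.
  by rewrite -(ltn_add2l d.+1) h addn0 -addn2.
move=> v'v.
have va : v != a by apply: contraNneq vs => ->.
have v'a : v' != a by apply: contraNneq v's => ->.
have := ws (s :\ a) a v' v ra; rewrite !inE eqxx (negbTE vs) (negbTE v's) !andbF /=.
move=> /(_ isT isT isT); rewrite ![a == _]eq_sym v'a va v'v => /(_ isT isT isT) kC.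
(* The separated set has more than [d] vertices, and [f @: s] has only [d]. *)
have [y] : exists2 y, y \in separated_link X (s :\ a) a v' v & y \notin f @: s.
  apply/subsetPn; apply/negP => /subset_leq_card; by rewrite cfs leqNgt (leq_trans dk kC).
rewrite !inE -andbA => /and3P[]; rewrite setUCA setD1K // => yl _ yv yfs.
have ylink : y \in link X s by rewrite inE.
have ys := notin_link XD sd ylink.
(* The preimage [x] of [y] lies in the link of [s] in [X'], and [f] maps [x |: s] to
   [y |: f @: s]. *)
have yN : y |: f @: s \in nbhd1 d X s.
  have : y \in cover (nbhd1 d X s) by rewrite cover_nbhd1 // inE ylink orbT.
  rewrite -fcov => /imsetP[x xc yx].
  have xs : x \notin s by apply: contra yfs => xs; rewrite yx imset_f.
  have xl : x \in link X' s.
    by move: xc; rewrite cover_nbhd1 // inE (negbTE xs).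
  have := nbhd1_link x X'D sd; rewrite xl => /andP[xN _].
  rewrite fiso ?imsetU1 -?yx // in xN.
  by rewrite subUset scov sub1set xc.
have [c2 _] := nbhd1_card XD sd yN.
(* At most two vertices of [y |: f @: s] are outside [s], and [y] is one of them. *)
have c1 : f @: s :\: s = [set v].
  apply/esym/eqP; rewrite eqEcard sub1set inE vs vfs cards1 /=.
  move: c2; rewrite setDUl; have -> : [set y] :\: s = [set y].
    by apply/setDidPl; rewrite disjoints1.
  by rewrite cardsU1 !inE (negbTE yfs) andbF.
have fE : f @: s = v |: (s :\ a).
  apply/eqP; rewrite eqEcard cfs cardsU1 ra !inE (negbTE vs) andbF add1n prednK // leqnn andbT.
  apply/subsetP => x xf; rewrite !inE; case: (boolP (x \in s)) => xs.
    by rewrite andbT (_ : x != a) ?orbT //; apply: contraNneq afs => <-.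
  have : x \in [set v] by rewrite -c1 inE xs.
  by rewrite inE => ->.
have := nbhd1_simplex yN; rewrite cardsU1 yfs cfs add1n fE => /(_ erefl).
by rewrite setUCA (negbTE yv).
Qed.

(** * Isomorphisms of neighbourhoods that preserve the centre *)

Section Isomorphism.
Variables (X X' : {set {set 'I_n}}) (s : {set 'I_n}) (f : 'I_n -> 'I_n).
Hypotheses (XD : X \subset simplices n d) (X'D : X' \subset simplices n d).
Hypothesis sd : #|s| = d.
Hypothesis finj : {in cover (nbhd1 d X' s) &, injective f}.
Hypothesis fcov : f @: cover (nbhd1 d X' s) = cover (nbhd1 d X s).
Hypothesis fiso : forall t, t \subset cover (nbhd1 d X' s) ->
  (t \in nbhd1 d X' s) = (f @: t \in nbhd1 d X s).
Hypothesis fs : f @: s = s.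

Let center_cover x : x \in s -> x \in cover (nbhd1 d X' s).
Proof. by rewrite cover_nbhd1 // => xs; rewrite inE xs. Qed.

Let link_cover x : x \in link X' s -> x \in cover (nbhd1 d X' s).
Proof. by rewrite cover_nbhd1 // => xs; rewrite in_setU xs orbT. Qed.

Lemma iso_center_mem x : x \in cover (nbhd1 d X' s) -> (f x \in s) = (x \in s).
Proof.
move=> xc; apply/idP/idP => [|xs]; last by rewrite -fs imset_f.
rewrite -{1}fs => /imsetP[x' x's] /finj; move: (center_cover x's) => x'c.
by move=> /(_ xc x'c) ->.
Qed.

Lemma iso_link x : x \in cover (nbhd1 d X' s) ->
  (f x \in link X s) = (x \in link X' s).
Proof.
move=> xc; have fxc : f x \in cover (nbhd1 d X s) by rewrite -fcov imset_f.
have xs := iso_center_mem xc; apply/idP/idP => xl.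
  move: (xc); rewrite cover_nbhd1 // in_setU -xs.
  by rewrite (negbTE (notin_link XD sd xl)).
move: fxc; rewrite cover_nbhd1 // in_setU xs.
by rewrite (negbTE (notin_link X'D sd xl)).
Qed.

(** Each cover is the disjoint union of [s] and its link. This equality turns one inclusion between
    the complexes into the other. *)
Lemma card_iso_link : #|link X' s| = #|link X s|.
Proof.
have := card_in_imset finj; rewrite fcov !cover_nbhd1 //.
by rewrite !cardsU !disjoint_link // !cards0 !subn0 => /eqP; rewrite eqn_add2l => /eqP.
Qed.

Lemma iso_facet y : y \in s -> f @: (s :\ y) = s :\ f y.
Proof.
move=> ys; apply/setP => z; rewrite in_setD1; apply/imsetP/andP => [[x]|[zy]].
  rewrite in_setD1 => /andP[xy xs] ->; split; last by rewrite -fs imset_f.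
  by apply: contraNneq xy => /finj ->//; apply: center_cover.
rewrite -{1}fs => /imsetP[x xs zx]; exists x => //; rewrite in_setD1 xs andbT.
by apply: contraNneq zy => <-; rewrite zx.
Qed.

Lemma iso_link2 y v w : y \in s -> v \in link X' s -> w \in link X' s ->
  v != w ->
  (v |: (w |: (s :\ y)) \in X') = (f v |: (f w |: (s :\ f y)) \in X).
Proof.
move=> ys vl wl vw; have [vc wc] := (link_cover vl, link_cover wl).
have fvw : f v != f w by apply: contraNneq vw => /finj ->.
have yc := center_cover ys; rewrite -nbhd1_link2 //.
rewrite -[RHS]nbhd1_link2 ?iso_link ?iso_center_mem //.
rewrite fiso ?imsetU1 ?iso_facet // !subUset !sub1set vc wc /=.
by apply/subsetP => x; rewrite in_setD1 => /andP[_ /center_cover].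
Qed.

Lemma common_link_sub y x : y \in s ->
  common_link X' (s :\ y) x y \subset link X' s.
Proof.
move=> ys; apply/subsetP => w; rewrite inE => /andP[_].
by rewrite setUCA setD1K // inE.
Qed.

Lemma iso_common_link y x : y \in s -> x \in link X' s ->
  f @: common_link X' (s :\ y) x y = common_link X (s :\ f y) (f x) (f y).
Proof.
move=> ys xl; have fys : f y \in s by rewrite iso_center_mem ?center_cover.
have key w : w \in link X' s ->
    (w \in common_link X' (s :\ y) x y) =
    (f w \in common_link X (s :\ f y) (f x) (f y)).
  move=> wl; rewrite !inE ![y |: _]setUCA ![f y |: _]setUCA !setD1K //.
  have -> : f w |: s \in X by have := wl; rewrite -iso_link ?link_cover // inE.
  have -> : w |: s \in X' by rewrite inE in wl.
  (* If [w] is [x], both sides are false: the repetition leaves only [d] vertices. *)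
  rewrite !andbT; case: (eqVneq x w) => [<-|xw]; last exact: iso_link2.
  have dn X0 z a : X0 \subset simplices n d -> z \notin s -> a \in s ->
      z |: (z |: s :\ a) \notin X0.
    move=> X0D zs sa; apply/negP => /(card_simplex X0D).
    rewrite setUA setUid cardsU1 !inE (negbTE zs) andbF add1n.
    have := cardsD1 a s; rewrite sa sd add1n => <- /eqP.
    by rewrite -[X in X == _]addn0 -addn1 eqn_add2l.
  have xs := notin_link X'D sd xl.
  by rewrite !(negbTE (dn _ _ _ _ _ _)) // iso_center_mem ?link_cover.
apply/setP => z; apply/imsetP/idP => [[w wW ->]|zW].
  by rewrite -key // (subsetP (common_link_sub _ ys) _ wW).
have zl : z \in link X s.
  by move: zW; rewrite inE => /andP[_]; rewrite setUCA setD1K // inE.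
have : z \in cover (nbhd1 d X s) by rewrite cover_nbhd1 // in_setU zl orbT.
rewrite -fcov => /imsetP[w wc zw]; exists w => //.
by rewrite key ?zw -?zw // -iso_link // -zw.
Qed.

End Isomorphism.

(** Condition (b). Only pairs with one index in each half of ['I_m + 'I_m] are compared, so that an
    injective tuple outside the ridge gives [m * m] distinct simplices. *)
Definition twin_free X m := forall r1 r2 (a b : {ffun 'I_m + 'I_m -> 'I_n}),
  #|r1| = d.-1 -> #|r2| = d.-1 -> injective a -> injective b ->
  (forall i, a i \notin r1) -> (forall i, b i \notin r2) ->
  (forall i j k l, a (inl i) |: (a (inr j) |: r1) !=
                   b (inl k) |: (b (inr l) |: r2)) ->
  ~ (forall i j, (a (inl i) |: (a (inr j) |: r1) \in X) =
                 (b (inl i) |: (b (inr j) |: r2) \in X)).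

Lemma notin_common_link X r u v w : X \subset simplices n d -> #|r| = d.-1 ->
  w \in common_link X r u v -> w \notin r.
Proof.
move=> XD rd; rewrite inE => /andP[/(card_simplex XD) + _]; rewrite !cardsU1 rd.
by case: (w \in r) => //=; case: (u \notin _) => /=; lia.
Qed.

(** If the two simplices differ, separation provides 2m vertices of the first common link for which
    the two systems are disjoint, although [f] and [g] carry the same graph onto both. This
    contradicts [twin_free]. *)
Lemma twin_free_eq X m r1 r2 x1 y1 x2 y2 (W : {set 'I_n}) (f g : 'I_n -> 'I_n) :
  X \subset simplices n d -> well_separated X (m + m + d) -> twin_free X m ->
  (d + 2 <= n)%N -> #|r1| = d.-1 -> #|r2| = d.-1 ->
  y1 |: (x1 |: r1) \in X -> y2 |: (x2 |: r2) \in X ->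
  {in W &, injective f} -> {in W &, injective g} ->
  f @: W = common_link X r1 x1 y1 -> g @: W = common_link X r2 x2 y2 ->
  {in W &, forall w w', w != w' ->
    (f w |: (f w' |: r1) \in X) = (g w |: (g w' |: r2) \in X)} ->
  y1 |: (x1 |: r1) = y2 |: (x2 |: r2).
Proof.
move=> XD ws tf dn c1 c2 t1X t2X fi gi fW gW fg.
have ct1 := card_simplex XD t1X; have ct2 := card_simplex XD t2X.
have disj x y r : #|r| = d.-1 -> #|y |: (x |: r)| = d.+1 ->
    [/\ x \notin r, y \notin r & x != y].
  move=> rd; rewrite !cardsU1 rd !inE negb_or [y == x]eq_sym.
  by case: (x \in r); case: (y \in r); case: (x == y) => //=; lia.
have [x1r y1r xy1] := disj _ _ _ c1 ct1; have [x2r y2r xy2] := disj _ _ _ c2 ct2.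
apply/eqP/negPn/negP => neq.
(* It suffices to find [U] with at least 2m preimages in [W] such that no simplex is shared: the
   tuples are then [f] and [g] composed with an injection [h] into these preimages. *)
have sub (U : {set 'I_n}) : (m + m <= #|[set w in W | f w \in U]|)%N ->
    (forall w1 w2 w3 w4, w1 \in W -> w2 \in W -> w3 \in W -> w4 \in W ->
      f w1 \in U -> f w2 \in U ->
      f w1 |: (f w2 |: r1) != g w3 |: (g w4 |: r2)) -> False.
  move=> mU hU.
  have [h hi hW] : exists2 h : 'I_m + 'I_m -> 'I_n, injective h &
      forall i, h i \in [set w in W | f w \in U].
    by apply: inj_into; rewrite card_sum card_ord.
  have hWW i : h i \in W by have := hW i; rewrite inE => /andP[].
  have hWU i : f (h i) \in U by have := hW i; rewrite inE => /andP[].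
  apply: (tf r1 r2 [ffun i => f (h i)] [ffun i => g (h i)]) => //.
  - by move=> i j; rewrite !ffunE => /fi /hi; apply.
  - by move=> i j; rewrite !ffunE => /gi /hi; apply.
  - move=> i; rewrite ffunE; apply: (@notin_common_link X _ x1 y1) => //.
    by rewrite -fW imset_f.
  - move=> i; rewrite ffunE; apply: (@notin_common_link X _ x2 y2) => //.
    by rewrite -gW imset_f.
  - by move=> i j k l; rewrite !ffunE; apply: hU.
  - by move=> i j; rewrite !ffunE; apply: fg => //; apply/eqP => /hi.
have card_pre (U : {set 'I_n}) : U \subset common_link X r1 x1 y1 ->
    (#|U| <= #|[set w in W | f w \in U]|)%N.
  move=> UW; apply: leq_trans (leq_imset_card f _); apply: subset_leq_card.
  apply/subsetP => u uU; have := subsetP UW _ uU; rewrite -fW => /imsetP[w wW uw].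
  by rewrite uw imset_f // inE wW -uw.
have sepW z : z \notin y1 |: (x1 |: r1) ->
    (m + m + d <= #|separated_link X r1 x1 y1 z|)%N /\
    separated_link X r1 x1 y1 z \subset common_link X r1 x1 y1.
  rewrite !inE !negb_or => /and3P[zy zx zr]; split.
    by apply: ws => //; rewrite eq_sym.
  by apply/subsetP => w; rewrite inE => /andP[].
(* For equal ridges, [z] lies in the second simplex only, so it is [x2] or [y2] and every [g w] is
   adjacent to it. The vertices of [U] are not adjacent to [z], hence differ from every [g w]. *)
case: (eqVneq r1 r2) => [r12|r12].
  have [z] : exists2 z, z \in y2 |: (x2 |: r2) & z \notin y1 |: (x1 |: r1).
    apply/subsetPn; apply: contra neq => h.
    by rewrite eq_sym eqEcard h ct1 ct2 leqnn.
  move=> z2 z1; have [ckz subz] := sepW z z1.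
  apply: (sub (separated_link X r1 x1 y1 z)).
    by apply: leq_trans (card_pre _ subz); apply: leq_trans ckz; rewrite leq_addr.
  move=> w1 w2 w3 w4 w1W w2W w3W w4W; rewrite inE => /andP[f1 f1z] _; apply/eqP => E.
  have f1r : f w1 \notin r1 by apply: notin_common_link f1.
  have inW2 w : w \in W -> z |: (g w |: r1) \in X.
    move=> wW; have : g w \in common_link X r2 x2 y2 by rewrite -gW imset_f.
    rewrite inE -r12 => /andP[gx gy]; move: z2 z1; rewrite -r12 !inE.
    by case/or3P => [/eqP->|/eqP->|->]; rewrite ?orbT.
  have : f w1 \in g w3 |: (g w4 |: r2) by rewrite -E setU11.
  rewrite -r12 !inE (negbTE f1r) orbF => /orP[] /eqP fw.
    by rewrite fw inW2 in f1z.
  by rewrite fw inW2 in f1z.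
(* For different ridges, [z] is any vertex outside the first simplex. Removing [r2] costs at most
   [d] vertices, which explains the summand [d] in [m + m + d]. A shared simplex would contain some
   [q] of [r2] outside [r1], but [f w1] and [f w2] avoid [r2]. *)
have [z z1] : exists z, z \in ~: (y1 |: (x1 |: r1)).
  apply/card_gt0P; have := cardsC (y1 |: (x1 |: r1)).
  by rewrite ct1 card_ord => h; rewrite -(ltn_add2l d.+1) h addn0 -addn2.
have z1N : z \notin y1 |: (x1 |: r1) by rewrite inE in z1.
have [ckz subz] := sepW z z1N.
apply: (sub (separated_link X r1 x1 y1 z :\: r2)).
  apply: leq_trans (card_pre _ _); last by apply: fintype.subset_trans subz; exact: subsetDl.
  have h : (#|separated_link X r1 x1 y1 z :&: r2| <= d)%N.
    by apply: leq_trans (subset_leq_card (subsetIr _ _)) _; rewrite c2 leq_pred.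
  rewrite -(leq_add2r d); apply: leq_trans ckz _.
  by rewrite -(cardsID r2 (separated_link X r1 x1 y1 z)) addnC leq_add2l.
move=> w1 w2 w3 w4 _ _ _ _; rewrite inE => /andP[f1 _]; rewrite inE => /andP[f2 _].
apply/eqP => E; have /subsetPn[q q2 q1] : ~~ (r2 \subset r1).
  by apply: contra r12 => h; rewrite eq_sym eqEcard h c1 c2 leqnn.
have : q \in f w1 |: (f w2 |: r1) by rewrite E !inE q2 !orbT.
rewrite !inE (negbTE q1) orbF => /orP[] /eqP qf; move: f1 f2; rewrite -qf q2 //.
Qed.

Lemma exactly_reconstructable_twin_free X m :
  X \subset simplices n d -> well_separated X (m + m + d) -> (0 < m)%N ->
  twin_free X m -> (d + 2 <= n)%N -> exactly_reconstructable d X.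
Proof.
move=> XD ws m0 tf dn X' X'D iso.
have dk : (d < m + m + d)%N by lia.
suff sXX : X' \subset X.
  (* Given one inclusion, the link of [t :\ x] in [X'] lies in its link in [X] and has the same
     cardinality, so the two agree and [x] is in both. *)
  congr complex_of; apply/eqP; rewrite eqEsubset sXX /=; apply/subsetP => t tX.
  have td := card_simplex XD tX.
  have [x xt] : exists x, x \in t by apply/card_gt0P; rewrite td.
  have sd : #|t :\ x| = d by have := cardsD1 x t; rewrite xt td add1n => -[].
  have [f [finj fcov fiso]] : isomorphic (nbhd1 d X' (t :\ x)) (nbhd1 d X (t :\ x)).
    by apply: iso; rewrite facetE sd.
  have : x \in link X (t :\ x) by rewrite inE setD1K.
  have /eqP <- : link X' (t :\ x) == link X (t :\ x).
    rewrite eqEcard (card_iso_link XD X'D sd finj fcov) leqnn andbT.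
    by apply/subsetP => y; rewrite !inE; apply: (subsetP sXX).
  by rewrite inE setD1K.
apply/subsetP => t tX'; have td := card_simplex X'D tX'.
have [x xt] : exists x, x \in t by apply/card_gt0P; rewrite td.
have sxd : #|t :\ x| = d by have := cardsD1 x t; rewrite xt td add1n => -[].
have [y ysx] : exists y, y \in t :\ x by apply/card_gt0P; rewrite sxd.
have [yx yt] : y != x /\ y \in t by move: ysx; rewrite in_setD1 => /andP[].
have syd : #|t :\ y| = d by have := cardsD1 y t; rewrite yt td add1n => -[].
have xsy : x \in t :\ y by rewrite in_setD1 eq_sym yx.
have [f [finj fcov fiso]] : isomorphic (nbhd1 d X' (t :\ x)) (nbhd1 d X (t :\ x)).
  by apply: iso; rewrite facetE sxd.
have [g [ginj gcov giso]] : isomorphic (nbhd1 d X' (t :\ y)) (nbhd1 d X (t :\ y)).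
  by apply: iso; rewrite facetE syd.
have fs := iso_center XD X'D sxd ws dk dn finj fcov fiso.
have gs := iso_center XD X'D syd ws dk dn ginj gcov giso.
have xl : x \in link X' (t :\ x) by rewrite inE setD1K.
have yl : y \in link X' (t :\ y) by rewrite inE setD1K.
have xc : x \in cover (nbhd1 d X' (t :\ x)) by rewrite cover_nbhd1 // in_setU xl orbT.
have yc : y \in cover (nbhd1 d X' (t :\ y)) by rewrite cover_nbhd1 // in_setU yl orbT.
have yc' : y \in cover (nbhd1 d X' (t :\ x)) by rewrite cover_nbhd1 // in_setU ysx.
have xc' : x \in cover (nbhd1 d X' (t :\ y)) by rewrite cover_nbhd1 // in_setU xsy.
have fys : f y \in t :\ x by rewrite (iso_center_mem X'D sxd finj fs).
have gxs : g x \in t :\ y by rewrite (iso_center_mem X'D syd ginj gs).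
have fxl : f x \in link X (t :\ x) by rewrite (iso_link XD X'D sxd finj fcov fs).
have gyl : g y \in link X (t :\ y) by rewrite (iso_link XD X'D syd ginj gcov gs).
(* Both isomorphisms act on the same graph, that of the common link of [x] and [y] over the ridge
   [t :\ x :\ y]. *)
have rE : t :\ y :\ x = t :\ x :\ y by rewrite setDDl setUC -setDDl.
have cW : common_link X' (t :\ y :\ x) y x = common_link X' (t :\ x :\ y) x y.
  by rewrite rE; apply/setP => w; rewrite !inE andbC.
have subf := common_link_sub X' x ysx; have subg := common_link_sub X' y xsy.
have cardr a s : #|s| = d -> a \in s -> #|s :\ a| = d.-1.
  by move=> sd sa; have := cardsD1 a s; rewrite sa sd add1n => ->.
have : f y |: (f x |: (t :\ x :\ f y)) = g x |: (g y |: (t :\ y :\ g x)).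
  apply: (@twin_free_eq X m _ _ _ _ _ _ (common_link X' (t :\ x :\ y) x y) f g) => //.
  - exact: cardr.
  - exact: cardr.
  - by rewrite setUCA setD1K //; rewrite inE in fxl.
  - by rewrite setUCA setD1K //; rewrite inE in gyl.
  - move=> a b /(subsetP subf) al /(subsetP subf) bl; apply: finj;
      by rewrite cover_nbhd1 // in_setU ?al ?bl orbT.
  - rewrite -cW => a b /(subsetP subg) al /(subsetP subg) bl; apply: ginj;
      by rewrite cover_nbhd1 // in_setU ?al ?bl orbT.
  - exact: (iso_common_link XD X'D sxd finj fcov fiso fs).
  - rewrite -cW; exact: (iso_common_link XD X'D syd ginj gcov giso gs).
  move=> a b aW bW ab.
  rewrite -(iso_link2 XD X'D sxd finj fcov fiso fs) // ?(subsetP subf) //.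
  have [aW' bW'] := (aW, bW); rewrite -cW in aW' bW'.
  by rewrite -rE -(iso_link2 XD X'D syd ginj gcov giso gs) // ?(subsetP subg).
(* Now [E] equates [f x |: t :\ x] with [g y |: t :\ y]. The right side contains [x], so the left
   side contains all of [t], and cardinalities agree. *)
rewrite setUCA [RHS]setUCA !setD1K // => E.
have tsub : t \subset f x |: (t :\ x).
  apply/subsetP => z zt; case: (eqVneq z x) => [->|zx].
    by rewrite E !inE xt [x == y]eq_sym yx orbT.
  by rewrite !inE zx zt orbT.
have fX : f x |: t :\ x \in X by rewrite inE in fxl.
suff -> : t = f x |: t :\ x by [].
by apply/eqP; rewrite eqEcard tsub (card_simplex XD fX) td leqnn.
Qed.

End Neighbourhoods.

(** * Expectations in the Linial-Meshulam model *)

Section Expectation.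
Import boot.fintype boot.finset.
Variables (R : realType) (n d : nat) (p : R).
Implicit Types (X Y : {set {set 'I_n}}) (t : {set 'I_n}).
Implicit Types (f g : {set {set 'I_n}} -> R).

Definition LM_expectation f : R :=
  \sum_(X : {set {set 'I_n}} | X \subset simplices n d) LM_mass d p X * f X.

Local Notation Ex := LM_expectation.

Lemma LM_probE (E : {set {set {set 'I_n}}}) :
  LM_prob d p E = Ex (fun X => (X \in E)%:R).
Proof.
rewrite /LM_prob /Ex big_mkcondl; apply: eq_bigr => X _.
by case: (X \in E); rewrite ?mulr1 ?mulr0.
Qed.

Lemma eq_expectation f g : f =1 g -> Ex f = Ex g.
Proof. by move=> fg; apply: eq_bigr => X _; rewrite fg. Qed.

Lemma expectation1 : Ex (fun=> 1) = 1.
Proof.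
have := LM_prob_supset p (sub0set (simplices n d)).
rewrite cards0 expr0 => h; rewrite -[RHS]h LM_probE; apply: eq_expectation => X.
by rewrite inE sub0set.
Qed.

Lemma expectationZ (c : R) f : Ex (fun X => c * f X) = c * Ex f.
Proof. by rewrite /Ex mulr_sumr; apply: eq_bigr => X _; rewrite mulrCA. Qed.

(** Conditioning on the status of [t]: both sides are sums over the pairs [X], [t |: X] with [t] not
    in [X]. *)
Lemma expectation_resample t f : t \in simplices n d ->
  Ex f = Ex (fun X => p * f (t |: X) + (1 - p) * f (X :\ t)).
Proof.
move=> tD.
pose M X : R := \prod_(x in simplices n d | x != t) (if x \in X then p else 1 - p).
have ME X : LM_mass d p X = (if t \in X then p else 1 - p) * M X.
  by rewrite /LM_mass (bigD1 t).
have split (h : {set {set 'I_n}} -> R) : Ex h =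
    \sum_(X : {set {set 'I_n}} | (X \subset simplices n d) && (t \notin X))
      (p * M X * h (t |: X) + (1 - p) * M X * h X).
  rewrite big_split /= /Ex (bigID (fun X => t \in X)) /=; congr (_ + _).
    rewrite (reindex_onto (fun X => t |: X) (fun X => X :\ t)) /=; last first.
      by move=> X /andP[_ tX]; rewrite setD1K.
    apply: eq_big => [X|X /andP[/andP[_ tX] _]].
      rewrite setU11 andbT subUset sub1set tD /=; congr (_ && _).
      apply/eqP/idP => [<-|tX]; first by rewrite !inE eqxx.
      by apply/setP => x; rewrite !inE; case: eqVneq => // ->; rewrite (negbTE tX).
    rewrite ME setU11; congr (_ * _ * _); apply: eq_bigr => x /andP[_ xt].
    by rewrite !inE (negbTE xt).
  by apply: eq_bigr => X /andP[_ tX]; rewrite ME (negbTE tX).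
rewrite !split; apply: eq_bigr => X /andP[_ tX].
have -> : t |: (t |: X) = t |: X by rewrite setUA setUid.
have -> : (t |: X) :\ t = X.
  by apply/setP => x; rewrite !inE; case: eqVneq => // ->; rewrite (negbTE tX).
have -> : X :\ t = X.
  by apply/setP => x; rewrite !inE; case: eqVneq => // ->; rewrite (negbTE tX).
by ring.
Qed.

Definition insensitive g t := forall X, g (t |: X) = g X /\ g (X :\ t) = g X.

(** Two independent simplices agree with probability [p ^+ 2 + (1 - p) ^+ 2], and [g] depends on
    neither of them. *)
Lemma expectation_pair g t1 t2 : t1 \in simplices n d -> t2 \in simplices n d ->
  t1 != t2 -> insensitive g t1 -> insensitive g t2 ->
  Ex (fun X => g X * ((t1 \in X) == (t2 \in X))%:R) =
  (1 - 2 * p * (1 - p)) * Ex g.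
Proof.
move=> D1 D2 t12 g1 g2; rewrite (expectation_resample _ D1) (expectation_resample _ D2).
rewrite -expectationZ; apply: eq_expectation => X.
rewrite !(proj1 (g1 _)) !(proj2 (g1 _)) !(proj1 (g2 _)) !(proj2 (g2 _)).
rewrite !inE ?eqxx /= ?(eq_sym t2) (negbTE t12) /= ?eqxx /=.
by ring.
Qed.

Lemma expectation_triple g t1 t2 t3 : t1 \in simplices n d ->
  t2 \in simplices n d -> t3 \in simplices n d ->
  t1 != t2 -> t1 != t3 -> t2 != t3 ->
  insensitive g t1 -> insensitive g t2 -> insensitive g t3 ->
  Ex (fun X => g X * (~~ [&& t1 \in X, t2 \in X & t3 \notin X])%:R) =
  (1 - p ^+ 2 * (1 - p)) * Ex g.
Proof.
move=> D1 D2 D3 t12 t13 t23 g1 g2 g3.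
rewrite (expectation_resample _ D1) (expectation_resample _ D2) (expectation_resample _ D3).
rewrite -expectationZ; apply: eq_expectation => X.
rewrite !(proj1 (g1 _)) !(proj2 (g1 _)) !(proj1 (g2 _)) !(proj2 (g2 _)).
rewrite !(proj1 (g3 _)) !(proj2 (g3 _)).
rewrite !inE !eqxx /= ?(eq_sym t2 t1) ?(eq_sym t3) (negbTE t12) (negbTE t13) (negbTE t23) /=.
by rewrite ?andbF /=; ring.
Qed.

(** Product rule for events [A i] governed by blocks [B i] of simplices. By induction, the
    conjunction of the remaining events serves as the factor [g] that is insensitive to the first
    block. *)
Lemma expectation_blocks (I : eqType) (s : seq I) (B : I -> {set {set 'I_n}})
    (A : I -> pred {set {set 'I_n}}) (c : R) :
  uniq s ->
  (forall i j t, i \in s -> j \in s -> i != j -> t \in B i ->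
     insensitive (fun X => (A j X)%:R) t) ->
  (forall i g, i \in s -> (forall t, t \in B i -> insensitive g t) ->
     Ex (fun X => g X * (A i X)%:R) = c * Ex g) ->
  Ex (fun X => (all (A^~ X) s)%:R) = c ^+ size s.
Proof.
elim: s => [|i s IH] /=; first by rewrite expectation1 expr0.
move=> /andP[iNs us] hB hA; rewrite exprS -IH //.
- rewrite -(hA i); rewrite ?mem_head //.
    by apply: eq_expectation => X; rewrite -natrM mulnb andbC.
  move=> t tB X.
  suff h X' : (forall j, j \in s -> A j X' = A j X) -> all (A^~ X') s = all (A^~ X) s.
    have [hU hD] : (forall j, j \in s -> A j (t |: X) = A j X) /\
        (forall j, j \in s -> A j (X :\ t) = A j X).
      split=> j js; have ij : i != j by apply: contraNneq iNs => ->.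
        have [+ _] := hB i j t (mem_head _ _) (mem_behead (s := i :: s) js) ij tB X.
        by move/eqP; rewrite eqr_nat; do 2![case: (A j _)].
      have [_] := hB i j t (mem_head _ _) (mem_behead (s := i :: s) js) ij tB X.
      by move/eqP; rewrite eqr_nat; do 2![case: (A j _)].
    by rewrite !h.
  by move=> h; apply: eq_in_all.
- by move=> a b t sa sb; apply: hB; apply: (mem_behead (s := i :: s)).
- by move=> a g sa; apply: hA; apply: (mem_behead (s := i :: s)).
Qed.

End Expectation.

(** * The union bound *)

Section UnionBound.
Import boot.fintype boot.finset.
Variables (R : realType) (n d : nat) (p : R).
Hypotheses (d_gt0 : (0 < d)%N) (p_ge0 : 0 <= p) (p_le1 : p <= 1).
Implicit Types (X : {set {set 'I_n}}) (t r : {set 'I_n}) (u v w z : 'I_n).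

Local Notation Ex := (@LM_expectation R n d p).

Lemma LM_mass_ge0 X : 0 <= LM_mass d p X.
Proof. by apply: prodr_ge0 => t _; case: ifP => _ //; rewrite subr_ge0. Qed.

Lemma le_expectation (f g : {set {set 'I_n}} -> R) :
  (forall X, X \subset simplices n d -> f X <= g X) -> Ex f <= Ex g.
Proof.
by move=> fg; apply: ler_sum => X XD; rewrite ler_wpM2l ?LM_mass_ge0 // fg.
Qed.

Lemma LM_prob_union (E : {set {set {set 'I_n}}}) (I : finType)
    (B : I -> pred {set {set 'I_n}}) :
  (forall X, X \subset simplices n d -> X \in E -> exists i, B i X) ->
  LM_prob d p E <= \sum_i Ex (fun X => (B i X)%:R).
Proof.
move=> EB; rewrite LM_probE exchange_big /=; apply: ler_sum => X XD.
rewrite -mulr_sumr ler_wpM2l ?LM_mass_ge0 //.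
case: (boolP (X \in E)) => [/(EB X XD)[i Bi]|_]; last by apply: sumr_ge0.
by rewrite (bigD1 i) //= Bi lerDl sumr_ge0.
Qed.

(** Index tuples that violate the side condition [b] contribute zero to the union bound. *)
Lemma expectation_cond (b : bool) (f : pred {set {set 'I_n}}) (c : R) :
  0 <= c -> (b -> Ex (fun X => (f X)%:R) <= c) ->
  Ex (fun X => (b && f X)%:R) <= c.
Proof.
by case: b => [_|c0 _] /=; [exact|rewrite /LM_expectation big1 // => X _; rewrite mulr0].
Qed.

Lemma insensitive_in t t' X : t' != t ->
  ((t' \in t |: X) = (t' \in X)) * ((t' \in X :\ t) = (t' \in X)).
Proof. by move=> tt'; rewrite !inE (negbTE tt'). Qed.

Lemma insensitive_pair t t1 t2 : t1 != t -> t2 != t ->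
  insensitive (fun X => ((t1 \in X) == (t2 \in X))%:R : R) t.
Proof. by move=> h1 h2 X; rewrite !(insensitive_in X h1) !(insensitive_in X h2). Qed.

Lemma insensitive_triple t t1 t2 t3 : t1 != t -> t2 != t -> t3 != t ->
  insensitive (fun X => (~~ [&& t1 \in X, t2 \in X & t3 \notin X])%:R : R) t.
Proof.
move=> h1 h2 h3 X.
by rewrite !(insensitive_in X h1) !(insensitive_in X h2) !(insensitive_in X h3).
Qed.

Lemma simplex_setU2 r u w : #|r| = d.-1 -> u \notin r -> w \notin r -> u != w ->
  u |: (w |: r) \in simplices n d.
Proof.
move=> rd ur wr uw; rewrite inE !cardsU1 rd !inE (negbTE uw) (negbTE ur) wr.
by rewrite !add1n prednK.
Qed.

(** Every [w] outside [r], [S] and the three vertices must fail to be separated. Each failure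
    concerns three simplices through [w], and different [w] give disjoint triples. In the
    application [S] enumerates a separated set that is too small. *)
Lemma expectation_separated r u v z (S : {set 'I_n}) k :
  #|r| = d.-1 -> u \notin r -> v \notin r -> z \notin r ->
  u != v -> u != z -> v != z -> (#|S| <= k)%N ->
  Ex (fun X => (separated_link X r u v z \subset S)%:R) <=
  (1 - p ^+ 2 * (1 - p)) ^+ (n - (d + 2 + k)).
Proof.
move=> rd ur vr zr uv uz vz Sk.
pose V := ~: (r :|: [set u; v; z] :|: S).
pose A w X := ~~ [&& u |: (w |: r) \in X, v |: (w |: r) \in X & z |: (w |: r) \notin X].
have VP w : w \in V -> [/\ w \notin r, w != u, w != v, w != z & w \notin S].
  by rewrite !inE !negb_or -!andbA => /and5P[].
have c0 : 0 <= 1 - p ^+ 2 * (1 - p).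
  by rewrite subr_ge0 mulr_ile1 ?exprn_ge0 ?exprn_ile1 ?subr_ge0 // gerBl.
have c1 : 1 - p ^+ 2 * (1 - p) <= 1.
  by rewrite gerBl mulr_ge0 ?exprn_ge0 // subr_ge0.
apply: (@le_trans _ _ (Ex (fun X => (all (A^~ X) (enum V))%:R))).
  apply: le_expectation => X _; rewrite ler_nat.
  case: (boolP (separated_link _ _ _ _ _ \subset S)) => // /subsetP sS.
  suff -> : all (A^~ X) (enum V) by [].
  apply/allP => w; rewrite mem_enum => /VP[_ _ _ _]; apply: contra => wA.
  by apply: sS; rewrite !inE -andbA.
pose B w := [set u |: (w |: r); v |: (w |: r); z |: (w |: r)].
rewrite (@expectation_blocks R n d p _ (enum V) B A (1 - p ^+ 2 * (1 - p))).
(* At most [(d - 1) + 3 + k] vertices are excluded, and powers of a number in [0, 1] decrease with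
   the exponent. *)
- apply: ler_wiXn2l => //; rewrite -cardE leq_subLR -[X in (X <= _)%N]card_ord.
  rewrite -(cardsC (r :|: [set u; v; z] :|: S)) leq_add2r.
  apply: leq_trans (leq_card_setU _ _) _; apply: leq_add Sk.
  apply: leq_trans (leq_card_setU _ _) _; rewrite rd setUC cardsU1 cards2.
  by rewrite !inE negb_or ![z == _]eq_sym uz vz uv; lia.
- exact: enum_uniq.
- have ne w1 w2 a b : w1 \in V -> w2 \in V -> w1 != w2 -> b \in [set u; v; z] ->
      a |: (w1 |: r) != b |: (w2 |: r).
    move=> /VP[w1r w1u w1v w1z _] _ w12 b3; apply/eqP => E.
    have : w1 \in b |: (w2 |: r) by rewrite -E !inE eqxx orbT.
    rewrite !inE (negbTE w12) (negbTE w1r) !orbF => /eqP w1b.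
    move: b3; rewrite -w1b !inE (negbTE w1u) (negbTE w1v) (negbTE w1z) //.
  move=> i j t; rewrite !mem_enum => iV jV ij tB.
  have tne a : a \in [set u; v; z] -> a |: (j |: r) != t.
    by move=> a3; move: tB; rewrite eq_sym !inE => /orP[/orP[]|] /eqP ->; apply: ne.
  by apply: insensitive_triple; apply: tne; rewrite !inE eqxx ?orbT.
move=> w g; rewrite mem_enum => /VP[wr wu wv wz _] gB.
have ne a b : a != b -> a \notin r -> w != a -> a |: (w |: r) != b |: (w |: r).
  move=> ab ar wa; apply/eqP => E; have : a \in b |: (w |: r) by rewrite -E setU11.
  by rewrite !inE (negbTE ab) (negbTE ar) eq_sym (negbTE wa).
apply: expectation_triple; rewrite ?simplex_setU2 ?ne //; try by rewrite eq_sym.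
- by apply: gB; rewrite !inE eqxx.
- by apply: gB; rewrite !inE eqxx orbT.
- by apply: gB; rewrite !inE eqxx !orbT.
Qed.

(** The two systems consist of [2 * m * m] distinct simplices, so the [m * m] agreements are
    independent. *)
Lemma expectation_twins m r1 r2 (a b : 'I_m + 'I_m -> 'I_n) :
  #|r1| = d.-1 -> #|r2| = d.-1 -> injective a -> injective b ->
  (forall i, a i \notin r1) -> (forall i, b i \notin r2) ->
  (forall i j k l, a (inl i) |: (a (inr j) |: r1) !=
                   b (inl k) |: (b (inr l) |: r2)) ->
  Ex (fun X => [forall i, forall j, (a (inl i) |: (a (inr j) |: r1) \in X) ==
                 (b (inl i) |: (b (inr j) |: r2) \in X)]%:R) =
  (1 - 2 * p * (1 - p)) ^+ (m * m).
Proof.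
move=> c1 c2 ai bi ar br ab.
pose fa (ij : 'I_m * 'I_m) := a (inl ij.1) |: (a (inr ij.2) |: r1).
pose fb (ij : 'I_m * 'I_m) := b (inl ij.1) |: (b (inr ij.2) |: r2).
(* The vertices [c (inl i)] and [c (inr j)] can be read off from the simplex, as the halves do not
   overlap and [r] is avoided. *)
have inj_pair (c : 'I_m + 'I_m -> 'I_n) r : injective c -> (forall i, c i \notin r) ->
    injective (fun ij : 'I_m * 'I_m => c (inl ij.1) |: (c (inr ij.2) |: r)).
  move=> ci cr [i j] [k l] /= E.
  have : c (inl i) \in c (inl k) |: (c (inr l) |: r) by rewrite -E setU11.
  rewrite !inE (negbTE (cr _)) orbF !(inj_eq ci) orbF => /eqP[->].
  have : c (inr j) \in c (inl k) |: (c (inr l) |: r) by rewrite -E !inE eqxx orbT.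
  by rewrite !inE (negbTE (cr _)) orbF !(inj_eq ci) => /eqP[->].
have fai : injective fa by exact: inj_pair.
have fbi : injective fb by exact: inj_pair.
have fab e e' : fa e != fb e' by exact: ab.
pose A e X := (fa e \in X) == (fb e \in X).
transitivity (Ex (fun X => (all (A^~ X) (enum {: 'I_m * 'I_m}))%:R)).
  apply: eq_expectation => X; congr (_%:R); congr nat_of_bool; apply/idP/idP.
    by move=> /forallP h; apply/allP => -[i j] _; have /forallP := h i; apply.
  move=> /allP h; apply/forallP => i; apply/forallP => j.
  by have := h (i, j); rewrite mem_enum; apply.
pose B e := [set fa e; fb e].
rewrite (@expectation_blocks R n d p _ _ B A (1 - 2 * p * (1 - p))).
- by rewrite -cardE card_prod card_ord.
- exact: enum_uniq.
- move=> i j t _ _ ij; rewrite !inE => /orP[] /eqP ->; apply: insensitive_pair.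
  + by rewrite (inj_eq fai) eq_sym.
  + by rewrite eq_sym.
  + by [].
  + by rewrite (inj_eq fbi) eq_sym.
move=> e g _ gB; apply: expectation_pair => //.
- by apply: simplex_setU2; rewrite ?(inj_eq ai).
- by apply: simplex_setU2; rewrite ?(inj_eq bi).
- by apply: gB; rewrite !inE eqxx.
- by apply: gB; rewrite !inE eqxx orbT.
Qed.

Lemma LM_prob_not_reconstructable m : (0 < m)%N -> (d + 2 <= n)%N ->
  LM_prob d p (~: [set X : {set {set 'I_n}} | `[< exactly_reconstructable d X >]])
  <= n%:R ^+ (d.-1 + 3 + (m + m + d)) *
       (1 - p ^+ 2 * (1 - p)) ^+ (n - (d + 2 + (m + m + d)))
     + n%:R ^+ (d.-1 + d.-1 + (m + m + (m + m))) *
       (1 - 2 * p * (1 - p)) ^+ (m * m).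
Proof.
move=> m0 dn; set k := (m + m + d)%N.
pose im j (s : {ffun 'I_j -> 'I_n}) := [set s i | i : 'I_j].
(* [I1] and [I2] index the possible failures of (a) and (b); their cardinalities are the powers of
   [n] in the bound. *)
pose I1 : finType :=
  ({ffun 'I_d.-1 -> 'I_n} * ('I_n * 'I_n * 'I_n) * {ffun 'I_k -> 'I_n})%type.
pose I2 : finType := ({ffun 'I_d.-1 -> 'I_n} * {ffun 'I_d.-1 -> 'I_n} *
  ({ffun 'I_m + 'I_m -> 'I_n} * {ffun 'I_m + 'I_m -> 'I_n}))%type.
pose B1 (i : I1) X :=
  let: (r, (u, v, z), s) := i in
  [&& #|im _ r| == d.-1, u \notin im _ r, v \notin im _ r, z \notin im _ r,
      u != v, u != z & v != z] && (separated_link X (im _ r) u v z \subset im _ s).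
pose C2 (i : I2) :=
  let: (r1, r2, (a, b)) := i in
  [/\ #|im _ r1| = d.-1, #|im _ r2| = d.-1, injective a, injective b &
   [/\ forall i, a i \notin im _ r1, forall i, b i \notin im _ r2 &
     forall i j k l, a (inl i) |: (a (inr j) |: im _ r1) !=
                   b (inl k) |: (b (inr l) |: im _ r2)]].
pose B2 (i : I2) X := `[< C2 i >] &&
  let: (r1, r2, (a, b)) := i in
  [forall i, forall j, (a (inl i) |: (a (inr j) |: im _ r1) \in X) ==
                 (b (inl i) |: (b (inr j) |: im _ r2) \in X)].
pose B (i : I1 + I2) := match i with inl i => B1 i | inr i => B2 i end.
have p1 : 0 <= 1 - p by rewrite subr_ge0.
have q1 : 0 <= 1 - p ^+ 2 * (1 - p).
  by rewrite subr_ge0 mulr_ile1 ?exprn_ge0 ?exprn_ile1 // gerBl.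
have q2 : 0 <= 1 - 2 * p * (1 - p).
  rewrite (_ : _ - _ = p ^+ 2 + (1 - p) ^+ 2); last by ring.
  by rewrite addr_ge0 ?exprn_ge0.
apply: le_trans (@LM_prob_union _ _ B _) _.
  have x0 : 'I_n by exists 0%N; lia.
  move=> X XD; rewrite inE inE => /asboolP NR; apply/not_existsP => NB; apply: NR.
  apply: (@exactly_reconstructable_twin_free n d d_gt0 X m) => //.
    (* A separated set with fewer than [k] elements is covered by the image of a [k]-tuple, which
       gives an index in [I1]. *)
    move=> r u v z rd ur vr zr uv uz vz; rewrite leqNgt; apply/negP => /ltnW.
    move=> /(subset_imset_ffun x0)[s sS]; have [r' rE] := eq_imset_ffun x0 rd.
    apply: (NB (inl (r', (u, v, z), s))).
    by rewrite /B /B1 /im -rE rd eqxx ur vr zr uv uz vz sS.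
  move=> r1 r2 a b c1 c2 ai bi ar br ab h.
  have [r1' r1E] := eq_imset_ffun x0 c1; have [r2' r2E] := eq_imset_ffun x0 c2.
  apply: (NB (inr (r1', r2', (a, b)))); rewrite /B /B2 /im -r1E -r2E.
  apply/andP; split; first by apply/asboolP; rewrite /C2 /im -r1E -r2E.
  by apply/forallP => i; apply/forallP => j; rewrite h.
rewrite big_sumType /=; apply: lerD.
  apply: (@le_trans _ _ (\sum_(i : I1) (1 - p ^+ 2 * (1 - p)) ^+ (n - (d + 2 + k)))).
    apply: ler_sum => -[[r [[u v] z]] s] _; apply: expectation_cond; first exact: exprn_ge0.
    move=> /and5P[/eqP rd ur vr zr /and3P[uv uz vz]].
    apply: expectation_separated => //.
    by apply: leq_trans (leq_imset_card _ _) _; rewrite card_ord.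
  rewrite sumr_const -[leLHS]mulr_natl !card_prod !card_ffun !card_ord.
  have <- : (n ^ (d.-1 + 3 + k) = n ^ d.-1 * (n * n * n) * n ^ k)%N.
    by rewrite !expnD; congr (_ * _ * _)%N; rewrite !expnS expn0 muln1 mulnA.
  by rewrite natrX.
apply: (@le_trans _ _ (\sum_(i : I2) (1 - 2 * p * (1 - p)) ^+ (m * m))).
  apply: ler_sum => -[[r1 r2] [a b]] _; apply: expectation_cond; first exact: exprn_ge0.
  move=> /asboolP[c1 c2 ai bi [ar br ab]].
  by rewrite (expectation_twins c1 c2 ai bi ar br ab).
rewrite sumr_const -[leLHS]mulr_natl !card_prod !card_ffun !card_sum !card_ord.
by rewrite -!expnD natrX.
Qed.

End UnionBound.

(** * Asymptotics *)

(** This combines [1 - q <= expR (- q)] with [N = expR (ln N)]. *)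
Lemma expR_bound (R : realType) (N c q : R) (e k : nat) :
  0 < N -> 0 <= c -> c <= 1 - q ->
  N ^+ e * c ^+ k <= expR (e%:R * ln N - q * k%:R).
Proof.
move=> N0 c0 cq; rewrite expRD -mulNr.
rewrite [e%:R * _]mulrC !expRM_natr lnK // ler_pM2l ?exprn_gt0 //.
rewrite lerXn2r ?nnegrE ?expR_ge0 //.
by apply: le_trans cq _; rewrite expR_ge1Dx.
Qed.

(** From [p <= 1 / 2] one gets [p ^+ 2 * (1 - p) >= p ^+ 2 / 2]. The exponent [e] of [n] is at most
    [(4 * d + 8) * y] and at most [n / 2], so the decay in the exponential is at least
    [y * g / 4]. *)
Lemma separation_tail (R : realType) (n m d : nat) (p y g : R) :
  (0 < d)%N -> (0 < n)%N -> 0 <= p -> 2 * p <= 1 -> 1 <= y ->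
  m%:R <= 2 * y -> p ^+ 2 * n%:R = y * g ->
  (16 * d + 40)%:R * ln n%:R <= g -> (16 * d + 40)%:R <= g ->
  n%:R ^+ (d.-1 + 3 + (m + m + d)) *
    (1 - p ^+ 2 * (1 - p)) ^+ (n - (d + 2 + (m + m + d))) <=
  expR (- (2 * ln n%:R)).
Proof.
move=> d_gt0 n_gt0 p_ge0 p_le y_ge1 my pn; rewrite natrD natrM => gL gK.
have N0 : 0 < n%:R :> R by rewrite ltr0n.
have D_ge1 : 1 <= d%:R :> R by rewrite ler1n.
have L_ge0 : 0 <= ln n%:R :> R by rewrite ln_ge0 // ler1n.
have p2 : 0 <= p ^+ 2 by rewrite exprn_ge0.
have p21 : p ^+ 2 <= 1 by rewrite exprn_ile1 //; lra.
apply: le_trans (expR_bound (q := p ^+ 2 / 2) _ _ N0 _ _) _.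
- by rewrite subr_ge0 mulr_ile1 //; lra.
- by nra.
have -> : (d.-1 + 3 + (m + m + d) = d + 2 + (m + m + d))%N.
  by congr (_ + _)%N; rewrite -[in RHS](prednK d_gt0) addSnnS.
set e := (d + 2 + _)%N.
have eE : e%:R = 2 * m%:R + 2 * d%:R + 2 :> R by rewrite /e !natrD; ring.
have e_le : e%:R <= (4 * d%:R + 8) * y by rewrite eE; nra.
have e_n : e%:R <= n%:R / 2 :> R.
  have : p ^+ 2 * n%:R <= n%:R by rewrite ler_piMl.
  by rewrite pn => ?; nra.
have e_le_n : (e <= n)%N by rewrite -(ler_nat R); lra.
rewrite ler_expR natrB //; set L := ln n%:R in L_ge0 gL *.
have h1 : e%:R * L <= (4 * d%:R + 8) * y * L by rewrite ler_wpM2r.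
have h2 : p ^+ 2 / 2 * (n%:R / 2) <= p ^+ 2 / 2 * (n%:R - e%:R).
  by rewrite ler_wpM2l //; lra.
have h3 : p ^+ 2 / 2 * (n%:R / 2) = y * g / 4 by rewrite -pn; field.
(* As 16d + 40 = 4 ((4d + 8) + 2), a quarter of this product pays for [e * L] and leaves
   [2 * y * L >= 2 * L]. *)
have h4 : y * ((16 * d%:R + 40) * L) <= y * g by rewrite ler_wpM2l //; lra.
have h5 : L <= y * L by rewrite ler_peMl.
by nra.
Qed.

(** Here [2 * p * (1 - p) >= p], and [p * m * m >= g * m] dominates the entropy term, which is at
    most [(2 * d + 4) * m * ln n]. *)
Lemma twin_tail (R : realType) (n m d : nat) (p y g : R) :
  (0 < n)%N -> 0 <= p -> 2 * p <= 1 -> 1 <= y -> y <= m%:R ->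
  p * y = g -> (16 * d + 40)%:R * ln n%:R <= g ->
  n%:R ^+ (d.-1 + d.-1 + (m + m + (m + m))) *
    (1 - 2 * p * (1 - p)) ^+ (m * m) <= expR (- (2 * ln n%:R)).
Proof.
move=> n_gt0 p_ge0 p_le y_ge1 ym py; rewrite natrD natrM => gL.
have N0 : 0 < n%:R :> R by rewrite ltr0n.
have L_ge0 : 0 <= ln n%:R :> R by rewrite ln_ge0 // ler1n.
apply: le_trans (expR_bound (q := p) _ _ N0 _ _) _.
- by nra.
- by nra.
set e := (d.-1 + d.-1 + _)%N; set L := ln n%:R in L_ge0 gL *.
have D_ge0 : 0 <= d%:R :> R by [].
have m1 : 1 <= m%:R :> R by lra.
have e_le : e%:R <= (2 * d%:R + 4) * m%:R :> R.
  have : e%:R <= 2 * d%:R + 4 * m%:R :> R by rewrite -!natrM -natrD ler_nat /e; lia.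
  by nra.
have h1 : e%:R * L <= (2 * d%:R + 4) * m%:R * L by rewrite ler_wpM2r.
have pm : g <= p * m%:R by rewrite -py ler_wpM2l.
have h2 : g * m%:R <= p * m%:R * m%:R by rewrite ler_wpM2r.
have h3 : (16 * d%:R + 40) * L * m%:R <= g * m%:R by rewrite ler_wpM2r.
have h4 : L <= m%:R * L by rewrite ler_peMl.
rewrite ler_expR natrM mulrA.
have h5 : 0 <= d%:R * (m%:R * L) by rewrite !mulr_ge0.
by nra.
Qed.

Lemma near_powR_ge (R : realType) (a C : R) : 0 < a ->
  \forall n \near \oo%classic, C <= n%:R `^ a.
Proof.
move=> a0; near=> n.
pose M := Num.max C 1; have M0 : 0 <= M by rewrite le_max ler01 orbT.
apply: (@le_trans _ _ M); first by rewrite le_max lexx.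
have -> : M = (M `^ a^-1) `^ a by rewrite -powRrM mulVf ?gt_eqF // powRr1.
rewrite ge0_ler_powR ?nnegrE ?powR_ge0 ?(ltW a0) //.
by near: n; exact: nbhs_infty_ger.
Unshelve. all: by end_near. Qed.

(** With [h] the power of exponent [a / 2], one factor of [h * h] absorbs the constant and the other
    bounds [ln h]. *)
Lemma near_ln_le_powR (R : realType) (a C : R) : 0 < a -> 0 <= C ->
  \forall n \near \oo%classic, C * ln n%:R <= n%:R `^ a.
Proof.
move=> a0 C0; have a2 : 0 < a / 2 by rewrite divr_gt0.
near=> n.
have n0 : 0 < n%:R :> R by rewrite ltr0n; near: n; exact: nbhs_infty_gt.
set h := n%:R `^ (a / 2).
have h0 : 0 < h by rewrite powR_gt0.
have -> : n%:R `^ a = h * h by rewrite /h -powRD ?(gt_eqF n0) ?implybT // -splitr.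
have -> : ln n%:R = ln h / (a / 2) by rewrite /h ln_powR mulrC mulKf // gt_eqF.
have lh : ln h <= h by apply/ltW/ln_sublinear.
have Ch : C / (a / 2) <= h by rewrite /h; near: n; exact: near_powR_ge.
rewrite mulrCA mulrC; apply: (le_trans (y := C / (a / 2) * h)).
  by rewrite ler_wpM2l // divr_ge0 // ltW.
by rewrite ler_wpM2r // ltW.
Unshelve. all: by end_near. Qed.

Theorem theorem3p1 (R : realType) (d : nat) (alpha : R) (hd : (1 <= d)%N)
    (alpha_gt0 : 0 < alpha) (alpha_lt : alpha < 1 / 3%:R) :
  with_high_probability
    (fun n : nat => LM_prob (n := n) d (n%:R `^ (- alpha)))
    (fun n : nat => [set Xd : {set {set 'I_n}} |
                      `[< exactly_reconstructable d Xd >]]).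
Proof.
(* The size [m] is of order [n ^ b], and [n ^ c] is the common value of [p * y] and
   [p ^+ 2 * n / y]. Positivity of [c] is exactly [alpha < 1 / 3]. *)
pose b : R := (1 - alpha) / 2; pose c : R := (1 - 3 * alpha) / 2.
have b0 : 0 < b by rewrite /b; lra.
have c0 : 0 < c by rewrite /c; lra.
(* The failure probability is at most 2 n^-2, which is o(n^-1). *)
exists 1 => //; apply/eqoP => e e0; near=> n.
have n0 : (0 < n)%N by near: n; exact: nbhs_infty_gt.
have N0 : 0 < n%:R :> R by rewrite ltr0n.
have N1 : 1 <= n%:R :> R by rewrite ler1n.
have Nn0 : n%:R != 0 :> R by rewrite gt_eqF.
have dn : (d + 2 <= n)%N by near: n; exact: nbhs_infty_ge.
set p : R := n%:R `^ (- alpha).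
have p_ge0 : 0 <= p by rewrite powR_ge0.
have p_le : 2 * p <= 1.
  rewrite /p powRN ler_pdivrMr ?powR_gt0 // mul1r.
  by near: n; exact: near_powR_ge.
(* Rounding up by truncation plus one gives [0 < m] and [y <= m <= 2 * y]. *)
pose y : R := n%:R `^ b; pose m := (Num.truncn y).+1.
have y1 : 1 <= y by rewrite /y; near: n; exact: near_powR_ge.
have /andP[ty yt] : (Num.truncn y)%:R <= y < (Num.truncn y).+1%:R.
  by rewrite truncn_itv // powR_ge0.
have ym : y <= m%:R by exact: ltW.
have my : m%:R <= 2 * y by rewrite /m -natr1; lra.
have py : p * y = n%:R `^ c.
  by rewrite /p /y -powRD ?Nn0 ?implybT //; congr (_ `^ _); rewrite /b /c; lra.
have pn : p ^+ 2 * n%:R = y * n%:R `^ c.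
  rewrite expr2 -[X in _ * X = _](powRr1 (ltW N0)) /p /y -!powRD ?Nn0 ?implybT //.
  by congr (_ `^ _); rewrite /b /c; lra.
have gL : (16 * d + 40)%:R * ln n%:R <= n%:R `^ c.
  by near: n; exact: near_ln_le_powR.
have gK : (16 * d + 40)%:R <= n%:R `^ c by near: n; exact: near_powR_ge.
have p_le1 : p <= 1 by apply: le_trans p_le; rewrite ler_peMl // ler1n.
have := @LM_prob_not_reconstructable R n d p hd p_ge0 p_le1 m isT dn.
have := separation_tail hd n0 p_ge0 p_le y1 my pn gL gK.
have := twin_tail n0 p_ge0 p_le y1 ym py gL.
have -> : expR (- (2 * ln n%:R)) = n%:R^-1 ^+ 2 :> R.
  by rewrite -mulrN mulrC expRM_natr expRN lnK.
set P := LM_prob _ _ _; move=> h2 h1 hP.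
have P0 : 0 <= P by rewrite /P LM_probE; apply: sumr_ge0 => X _; rewrite mulr_ge0 ?LM_mass_ge0.
rewrite ger0_norm // ger0_norm ?powR_ge0 // powR_inv1 ?ler0n //.
apply: (@le_trans _ _ (2 * n%:R^-1 ^+ 2)).
  by apply: le_trans hP _; rewrite [leRHS]mulr_natl mulr2n lerD.
rewrite expr2 mulrA ler_wpM2r ?invr_ge0 ?ler0n //.
rewrite ler_pdivrMr // -ler_pdivrMl // mulrC.
by near: n; exact: nbhs_infty_ger.
Unshelve. all: by end_near. Qed.
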